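(* Let $a,b>0$ with $ab=1/2$ and let $\Lambda=a\mathbb{Z}\times b\mathbb{Z}$. Then, for every integer $n\ge 0$, the Gabor system $\mathcal{G}(H_{2n+1},\Lambda)=\{\pi_\lambda H_{2n+1}:\lambda\in\Lambda\}$ is not a frame for $L^2(\mathbb{R})$.
   Context: For $z=(x,\xi)\in\mathbb{R}^2$, the time-frequency shift is $\pi_z f(t)=e^{2\pi i\xi t}f(t-x)$. The Hermite functions are $H_k(t)=c_k e^{\pi t^2}\frac{d^k}{dt^k}e^{-2\pi t^2}$, $k=0,1,2,\dots$, with $c_k$ chosen so that $\|H_k\|_{L^2(\mathbb{R})}=1$. The system $\mathcal{G}(g,\Lambda)$ is a frame for $L^2(\mathbb{R})$ if there are constants $A,B>0$ such that $A\|f\|^2\le\sum_{\lambda\in\Lambda}|\langle f,\pi_\lambda g\rangle|^2\le B\|f\|^2$ for all $f\in L^2(\mathbb{R})$. *)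

(* Defs.v *)
From HB Require Import structures.
From mathcomp Require Import all_boot all_order all_algebra.
From mathcomp.real_closed Require Import complex.
From mathcomp Require Import all_classical all_reals all_analysis.

Set Implicit Arguments.
Unset Strict Implicit.
Unset Printing Implicit Defensive.

Import Order.TTheory GRing.Theory Num.Theory.
Import numFieldNormedType.Exports.
Import Normc.

Local Open Scope classical_set_scope.
Local Open Scope complex_scope.
Local Open Scope ring_scope.

Section Gabor.
Context {R : realType}.
Implicit Types (f g h : R -> R[i]) (z : R * R) (Lam : set (R * R)).

(* [normc] is the modulus with values in R; the norm `|_| of R[i] takes its
   values in R[i]. *)
Definition L2norm f : \bar R :=
  Lnorm (@lebesgue_measure R) 2%:E (fun t => (normc (f t))%:E).

(* Elements of L^2(R) are handled through Borel representatives; [L2norm] and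
   [L2inner] only depend on the almost-everywhere class. *)
Definition L2 : set (R -> R[i]) :=
  [set f | [/\ measurable_fun [set: R] (fun t => complex.Re (f t)),
               measurable_fun [set: R] (fun t => complex.Im (f t))
             & (L2norm f < +oo)%E]].

(* <f, g> is the integral of f * conj g, linear in the first argument. *)
Definition L2inner f g : R[i] :=
  (\int[@lebesgue_measure R]_t complex.Re (f t * (g t)^*))
  +i* (\int[@lebesgue_measure R]_t complex.Im (f t * (g t)^*)).

(* e^(i x) *)
Definition expi (x : R) : R[i] := cos x +i* sin x.

(* pi_z f for z = (x, xi) *)
Definition tfshift z f : R -> R[i] :=
  fun t => expi (2 * pi * z.2 * t) * f (t - z.1).

(* The sum over Lam is the unordered sum in [0, +oo]. *)
Definition gabor_frame g Lam : Prop :=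
  exists A B : R, [/\ 0 < A, 0 < B & forall f, L2 f ->
    (A%:E * L2norm f ^+ 2
       <= \esum_(l in Lam) ((normc (L2inner f (tfshift l g))) ^+ 2)%:E
       <= B%:E * L2norm f ^+ 2)%E].

(* The normalization determines c only up to a factor of modulus 1, so every
   such choice is allowed. *)
Definition is_hermite (k : nat) h : Prop :=
  exists c : R[i],
    (forall t, h t = c * (expR (pi * t ^+ 2)
                          * derive1n k (fun s : R => expR (- 2 * pi * s ^+ 2)) t)%:C)
    /\ L2norm h = 1%E.

Definition rect_lattice (a b : R) : set (R * R) :=
  range (fun m : int => a * m%:~R) `*` range (fun m : int => b * m%:~R).

End Gabor.

(* Main.v *)
Require Import Defs.
From mathcomp Require Import all_boot all_order all_algebra.
From mathcomp.real_closed Require Import complex.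
From mathcomp Require Import all_classical all_reals all_analysis.
From mathcomp Require Import measurable_realfun.
From mathcomp Require Import ring lra zify.

(** Write [H] for the (odd, rapidly decaying) Hermite function and test the
lower frame bound on [f_N = sum_(|k| <= N) 1_[2 a k - e, 2 a k + e]], whose
squared norm is at least [(2 N + 1) 2 e]. As [2 a b = 1], the coefficient of
[f_N] at [(a m, b n)] is, up to a constant and a conjugation, the Fourier
integral at frequency [n] over [[-e, e]] of
[P_m x = sum_(|k| <= N) H (x + 2 a k - a m)], so Bessel's inequality on a period
of length [2 a] bounds the sum over [n] by [2 a * int_[-e, e] |P_m|^2].
Since [H] is odd, the full sum over [k] in [Z] vanishes at [x = 0] for every
[m]; hence [P_m 0] is exponentially small unless [m] is close to [2 N] or
[- 2 N], and [sum_m |P_m x|^2] stays bounded independently of [N] once [e] is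
small enough. The frame sum is thus [O(e)] uniformly in [N], contradicting the
linear growth of the norms. *)

Set Implicit Arguments.
Unset Strict Implicit.
Unset Printing Implicit Defensive.

Import Order.TTheory GRing.Theory Num.Theory.
Import numFieldNormedType.Exports.
Import Normc.
Local Open Scope classical_set_scope.
Local Open Scope complex_scope.
Local Open Scope ring_scope.

Local Notation mu := (@lebesgue_measure _).

(** * Truncated sums of odd sequences *)

(** Arbitrary duplicate-free lists replace initial ranges because unordered sums over the lattice
    are bounded through their finite partial sums. *)
Lemma sum_geometric_nat (R : realType) (q : R) (s : seq nat) :
  0 <= q -> q < 1 -> uniq s -> \sum_(i <- s) q ^+ i <= (1 - q)^-1.
Proof.
move=> q0 q1 us.
have p1 : 0 < 1 - q by rewrite subr_gt0.
have [M sM] : exists M, forall i, i \in s -> (i < M)%N.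
  by exists (\max_(i <- s) i).+1 => i si; rewrite ltnS leq_bigmax_seq.
apply: (@le_trans _ _ (\sum_(i < M) q ^+ i)).
  rewrite -(big_mkord xpredT (fun i => q ^+ i)) /index_iota subn0.
  rewrite [leRHS](bigID (fun i => i \in s))/= -[X in X + _]big_filter.
  have Es : perm_eq [seq i <- iota 0 M | i \in s] s.
    apply: uniq_perm => [||i]; rewrite ?filter_uniq ?iota_uniq//.
    by rewrite mem_filter mem_iota add0n andb_idr// => /sM.
  by rewrite (perm_big _ Es) lerDl sumr_ge0// => i _; exact: exprn_ge0.
rewrite -[leLHS](mulKf (lt0r_neq0 p1)) ler_piMr ?invr_ge0 ?(ltW p1)//.
by rewrite -[1 - q]opprB mulNr -subrX1 opprB gerBl exprn_ge0.
Qed.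

(** On either side of [c] the distance to [c] is injective, so each half is a sum of distinct powers
    of [q]. *)
Lemma sum_geometric_int (R : realType) (q : R) (c : int) (s : seq int) :
  0 <= q -> q < 1 -> uniq s ->
  \sum_(i <- s) q ^+ absz (i - c) <= (1 - q)^-1 *+ 2.
Proof.
move=> q0 q1 us; rewrite (bigID (fun i => 0 <= i - c))/= mulr2n.
have half (P : pred int) : {in P &, injective (fun i => absz (i - c))} ->
    \sum_(i <- s | P i) q ^+ absz (i - c) <= (1 - q)^-1.
  move=> inj; rewrite -big_filter -(big_map (fun i => absz (i - c)) xpredT).
  apply: sum_geometric_nat => //; rewrite map_inj_in_uniq ?filter_uniq//.
  by move=> x y; rewrite !mem_filter => /andP[Px _] /andP[Py _]; exact: inj.
by apply: lerD; apply: half => x y; rewrite /in_mem/=; lia.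
Qed.

Section odd_sequence.
Variables (R : realType) (v : int -> R) (K q : R).
Hypotheses (K0 : 0 <= K) (q0 : 0 <= q) (q1 : q < 1).
Hypothesis v_odd : forall i, v (- i) = - v i.
Hypothesis v_decay : forall i, `|v i| <= K * q ^+ absz i.

Let geo (n : nat) : \sum_(0 <= j < n) q ^+ j <= (1 - q)^-1.
Proof. by apply: sum_geometric_nat; rewrite ?iota_uniq. Qed.

(** Read backwards from the last term, the indices start at distance at least [d] from 0 and recede
    by at least one at each step, so a geometric series dominates. *)
Let tail (d n : nat) (f : nat -> int) :
  (forall j, (j < n)%N -> (d + j <= absz (f (n - j.+1)%N))%N) ->
  `|\sum_(0 <= j < n) v (f j)| <= K / (1 - q) * q ^+ d.
Proof.
move=> df; rewrite big_nat_rev/= add0n (le_trans (ler_norm_sum _ _ _))//.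
apply: (@le_trans _ _ (\sum_(0 <= j < n) K * q ^+ d * q ^+ j)).
  rewrite !big_nat ler_sum// => j /df dj; rewrite (le_trans (v_decay _))//.
  by rewrite -mulrA -exprD ler_wpM2l// ler_wiXn2l// ltW.
by rewrite -mulr_sumr [leRHS]mulrAC ler_wpM2l// mulr_ge0// exprn_ge0.
Qed.

(* By oddness, the terms with index [j >= m] cancel in pairs under
   [j |-> 2 N + m - j]; only the [m] terms at one end remain. *)
Let sum_odd_nat (N m : nat) :
  `|\sum_(0 <= j < (2 * N).+1) v (2 * j%:Z - 2 * N%:Z - m%:Z)|
    <= K / (1 - q) * q ^+ absz (m%:Z - 2 * N%:Z)%R.
Proof.
have [mN|Nm] := leqP m (2 * N).
- rewrite (big_cat_nat (n := m))//=; last by lia.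
  set S := (X in _ + X).
  have -> : S = 0.
    suff : S = - S by move=> SN; lra.
    rewrite {1}/S big_nat_rev/= -sumrN; apply: eq_big_nat => j /andP[mj jN].
    by rewrite -v_odd; congr v; lia.
  by rewrite addr0; apply: tail => j; lia.
(* Nothing cancels here, but every index is at most [2 N - m < 0]. *)
- by apply: tail => j; lia.
Qed.

(** Reversing the sum and using oddness reduces negative [m] to positive [m]; keeping both powers of
    [q] gives one bound for either sign. *)
Lemma sum_odd (N : nat) (m : int) :
  `|\sum_(0 <= j < (2 * N).+1) v (2 * j%:Z - 2 * N%:Z - m)|
    <= K / (1 - q) * (q ^+ absz (m - 2 * N%:Z)%R + q ^+ absz (m + 2 * N%:Z)%R).
Proof.
have C0 : 0 <= K / (1 - q) by rewrite divr_ge0// subr_ge0 ltW.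
have [m0|m0] := leP 0 m.
- rewrite -[m]gez0_abs// (le_trans (sum_odd_nat _ _))// ler_wpM2l//.
  by rewrite lerDl exprn_ge0.
- rewrite big_nat_rev/= -normrN -sumrN.
  rewrite (eq_big_nat _ _
    (F2 := fun j => v (2 * j%:Z - 2 * N%:Z - (absz m)%:Z))); last first.
    by move=> j jN; rewrite -v_odd; congr v; lia.
  rewrite (le_trans (sum_odd_nat _ _))// ler_wpM2l//.
  have <- : absz (m + 2 * N%:Z)%R = absz ((absz m)%:Z - 2 * N%:Z)%R by lia.
  by rewrite lerDr exprn_ge0.
Qed.

End odd_sequence.

(** * Polynomials times Gaussians *)

Lemma is_derive_poly_gauss (R : realType) (p : {poly R}) (c t : R) :
  is_derive t 1 (fun s : R => p.[s] * expR (c * s ^+ 2))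
    ((p^`() + (2 * c) *: (p * 'X)).[t] * expR (c * t ^+ 2)).
Proof.
have dg : is_derive t 1 (fun s : R => expR (c * s ^+ 2))
    (2 * c * t * expR (c * t ^+ 2)).
  apply: is_derive_eq.
  have E (x y z : R) : x * (y * (z * 1 + z * 1)) = 2 * y * z * x by ring.
  exact: E.
apply: is_derive_eq.
rewrite /GRing.scale/= hornerD hornerZ hornerMX.
have E (x y z w : R) : x * (2 * c * z * y) + y * w = (w + 2 * c * (x * z)) * y.
  by ring.
exact: E.
Qed.

(** Differentiation and multiplication by ['X] both flip parity, so the polynomial factor has the
    parity of [k]. This is the source of the oddness of the Hermite function. *)
Lemma derive1n_gauss (R : realType) (c : R) (k : nat) :
  exists p : {poly R}, p \Po - 'X = (-1) ^+ k *: p /\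
    derive1n k (fun s : R => expR (c * s ^+ 2)) =
      fun s => p.[s] * expR (c * s ^+ 2).
Proof.
elim: k => [|k [p [pN pE]]].
  exists 1; rewrite comp_polyC expr0 scale1r; split=> //.
  by apply/funext => s; rewrite hornerE mul1r.
exists (p^`() + (2 * c) *: (p * 'X)); split.
  have := congr1 deriv pN; rewrite deriv_comp derivN derivX derivZ mulrN1.
  move=> /(congr1 -%R); rewrite opprK => dpN.
  rewrite comp_polyD comp_polyZ comp_polyM comp_polyX dpN pN exprS mulN1r.
  rewrite scalerDr !scaleNr mulrN -scalerAl scalerN.
  by rewrite !scalerA mulrC.
rewrite derive1nS pE; apply/funext => s; rewrite derive1E.
by have [_ ->] := is_derive_poly_gauss p c s.
Qed.

(** Each monomial satisfies [|t|^i <= i! exp |t|], and the Gaussian absorbs the exponential because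
    [2 |t| <= 1 + t^2 <= 1 + pi t^2]. *)
Lemma poly_gauss_decay (R : realType) (p : {poly R}) :
  exists K : R, 0 <= K /\
    forall t, `|p.[t] * expR (- pi * t ^+ 2)| <= K * expR (- `|t|).
Proof.
pose C := \sum_(i < size p) `|p`_i| * i`!%:R.
have C0 : 0 <= C by apply: sumr_ge0 => i _; rewrite mulr_ge0.
have pC t : `|p.[t]| <= C * expR `|t|.
  rewrite horner_coef (le_trans (ler_norm_sum _ _ _))// mulr_suml ler_sum//.
  move=> [i ip] _ /=; rewrite normrM normrX -mulrA ler_wpM2l//.
  case: i {ip} => [|i]; first by rewrite expr0 fact0 mul1r -expR0 ler_expR.
  rewrite -ler_pdivrMl ?ltr0n ?fact_gt0// mulrC.
  by rewrite (le_trans _ (expR_ge1Dxn i (normr_ge0 t)))// lerDr.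
exists (C * expR 1); split; first by rewrite mulr_ge0// expR_ge0.
move=> t; rewrite normrM [`|expR _|]ger0_norm ?expR_ge0//.
apply: (le_trans (ler_wpM2r (expR_ge0 _) (pC t))).
rewrite -!mulrA -!expRD ler_wpM2l// ler_expR.
have := pi_ge2 R; have := sqr_ge0 (`|t| - 1); rewrite -(real_normK (num_real t)).
by have := normr_ge0 t; nra.
Qed.

(** By the mean value theorem: the derivative is again a polynomial times the same Gaussian, hence
    decays, and moving its argument by at most 1 costs a factor [expR 1]. *)
Lemma poly_gauss_lipschitz (R : realType) (p : {poly R}) :
  exists K : R, 0 <= K /\ forall t x, `|x| <= 1 ->
    `|p.[t + x] * expR (- pi * (t + x) ^+ 2) - p.[t] * expR (- pi * t ^+ 2)|
      <= K * `|x| * expR (- `|t|).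
Proof.
have [K [K0 HK]] := poly_gauss_decay (p^`() + (2 * - pi) *: (p * 'X)).
exists (K * expR 1); split; first by rewrite mulr_ge0// expR_ge0.
pose f s : R := p.[s] * expR (- pi * s ^+ 2).
move=> t x x1; rewrite -/(f (t + x)) -/(f t).
suff H (u w : R) : u <= w -> `|u - t| <= 1 -> `|w - t| <= 1 ->
    `|f w - f u| <= K * expR 1 * (w - u) * expR (- `|t|).
  have tx : t + x - t = x by rewrite addrAC subrr add0r.
  have [x0|/ltW x0] := leP 0 x.
    have := H t (t + x); rewrite tx lerDl subrr normr0.
    by move=> /(_ x0 ler01 x1); rewrite (ger0_norm x0).
  have := H (t + x) t; rewrite tx gerDl subrr normr0 distrC opprD addNKr.
  by move=> /(_ x0 x1 ler01); rewrite (ler0_norm x0).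
move=> uw ut wt.
have dfs s := is_derive_poly_gauss p (- pi) s.
have [|c + ->] := MVT_segment uw (fun s _ => dfs s).
  apply: continuous_subspaceT => s.
  by apply/differentiable_continuous/derivable1_diffP/ex_derive.
rewrite in_itv/= => /andP[uc cw].
rewrite normrM [`|w - u|]ger0_norm ?subr_ge0// [leRHS]mulrAC ler_wpM2r ?subr_ge0//.
rewrite (le_trans (HK c))// -mulrA ler_wpM2l// -expRD ler_expR.
have ct : `|t - c| <= 1 by move: ut wt; rewrite !ler_norml; lra.
by have := ler_normD c (t - c); rewrite addrC subrK; lra.
Qed.

(* The sum [P_m] of the header, reindexed by [k = j - N]. *)
Definition lattice_sum (R : realType) (H : R -> R) (a : R) (N : nat) (m : int)
    (x : R) : R :=
  \sum_(0 <= j < (2 * N).+1) H (x + a * (2 * j%:Z - 2 * N%:Z - m)%:~R).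

(** The order of quantifiers is the point: [e] may shrink with [N], while [C] must not depend on
    [N]. *)
Lemma lattice_sum_bound (R : realType) (a K : R) (H : R -> R) :
  0 < a -> 0 <= K ->
  (forall t, H (- t) = - H t) ->
  (forall t, `|H t| <= K * expR (- `|t|)) ->
  (forall t x, `|x| <= 1 -> `|H (t + x) - H t| <= K * `|x| * expR (- `|t|)) ->
  exists C : R, forall N, exists e, exists B : int -> R,
    [/\ 0 < e, e <= a,
        (forall m x, `|x| <= e -> `|lattice_sum H a N m x| <= B m) &
        forall s : seq int, uniq s -> \sum_(m <- s) B m ^+ 2 <= C].
Proof.
move=> a0 K0 Hodd Hdec Hlip.
pose q := expR (- a).
have q0 : 0 < q by exact: expR_gt0.
have q1 : q < 1 by rewrite expR_lt1 oppr_lt0.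
have p0 : 0 < 1 - q by rewrite subr_gt0.
have expq (i : int) : expR (- `|a * i%:~R|) = q ^+ absz i.
  by rewrite normrM gtr0_norm// -intr_norm -mulNr -[`|i|]abszE expRM_natr.
pose K' := K / (1 - q).
have K'0 : 0 <= K' by rewrite divr_ge0// ltW.
have KK' : K <= K'.
  by rewrite ler_peMr// invf_ge1// gerBl ltW.
(* The bound will be [B m = K' * (u m + v m + w m)]. As [u], [v], [w] lie in [[0, 1]], the square of
   their sum is at most three times the sum, and each of them has total at most [(1 - q)^-1 *+ 2],
   whatever [N]. *)
exists (K' ^+ 2 * 3 * (3 * ((1 - q)^-1 *+ 2))) => N.
pose u m := q ^+ absz (m - 2 * N%:Z)%R.
pose v m := q ^+ absz (m + 2 * N%:Z)%R.
pose w (m : int) := q ^+ absz (m - 0)%R.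
have q01 (n : nat) : 0 <= q ^+ n <= 1.
  by rewrite exprn_ge0 ?exprn_ile1// ltW.
pose L : R := (2 * N).+1%:R.
have L0 : 0 < L by rewrite ltr0n.
(* [e <= a] keeps the segment within one period, [e <= 1] allows the Lipschitz bound, and
   [L * e <= q ^+ (2 * N)] makes the sum of the [L] Lipschitz errors at most [K' * w m]. *)
pose e := Num.min (Num.min a 1) (q ^+ (2 * N) / L).
have e0 : 0 < e by rewrite !lt_min a0 ltr01 divr_gt0// exprn_gt0.
exists e, (fun m => K' * (u m + v m + w m)); split => //.
- by rewrite !ge_min lexx.
- move=> m x xe.
  have x1 : `|x| <= 1 by rewrite (le_trans xe)// !ge_min lexx orbT.
  have xq : `|x| * L <= q ^+ (2 * N).
    by rewrite -ler_pdivlMr// (le_trans xe)// !ge_min lexx !orbT.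
  (* The value at 0 is controlled by oddness ([u] and [v]), the increment from 0 to [x] by the
     Lipschitz bound ([w]). *)
  rewrite -[lattice_sum _ _ _ _ _](subrK (lattice_sum H a N m 0)).
  rewrite addrC (le_trans (ler_normD _ _))// mulrDr lerD//.
    rewrite /lattice_sum; under eq_bigr do rewrite add0r.
    apply: (@sum_odd R (fun i : int => H (a * i%:~R)) K q) => //.
    - exact: ltW.
    - by move=> i; rewrite mulrNz mulrN Hodd.
    - by move=> i; rewrite -expq.
  rewrite /lattice_sum -sumrB (le_trans (ler_norm_sum _ _ _))//.
  have Hj j : (j < (2 * N).+1)%N -> `|H (x + a * (2 * j%:Z - 2 * N%:Z - m)%:~R) -
      H (0 + a * (2 * j%:Z - 2 * N%:Z - m)%:~R)| <= K' * (L^-1 * w m).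
    move=> jN; rewrite add0r [x + _]addrC (le_trans (Hlip _ _ x1))// expq.
    rewrite -mulrA ler_pM ?mulr_ge0 ?exprn_ge0 ?(ltW q0)//.
    rewrite ler_pdivlMl// mulrA [L * _]mulrC.
    apply: (le_trans (ler_wpM2r _ xq)); first by rewrite exprn_ge0 ?(ltW q0).
    (* The exponents compare as [|m| <= 2 N + |2 j - 2 N - m|], since [|2 j - 2 N| <= 2 N]. *)
    rewrite -exprD; apply: ler_wiXn2l; rewrite ?ltW//.
    by move: jN; clear; lia.
  rewrite big_nat (le_trans (ler_sum _ (fun j => Hj j)))//.
  rewrite -big_nat sumr_const_nat subn0 -mulr_natr -/L.
  by rewrite -mulrA [L^-1 * _]mulrC mulfVK ?lt0r_neq0.
- move=> s us.
  apply: (@le_trans _ _ (\sum_(m <- s) K' ^+ 2 * 3 * (u m + v m + w m))).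
    apply: ler_sum => m _; rewrite exprMn -mulrA ler_wpM2l ?sqr_ge0//.
    rewrite /u /v /w; move: (q01 (absz (m - 2 * N%:Z)%R)).
    move: (q01 (absz (m + 2 * N%:Z)%R)) (q01 (absz (m - 0)%R)).
    move=> /andP[v0 v1] /andP[w0 w1] /andP[u0 u1].
    by rewrite expr2 ler_wpM2r; lra.
  rewrite -mulr_sumr; apply: ler_wpM2l; first by rewrite mulr_ge0 ?sqr_ge0.
  rewrite !big_split/=.
  have geo c : \sum_(i <- s) q ^+ absz (i - c)%R <= (1 - q)^-1 *+ 2.
    by apply: sum_geometric_int => //; exact: ltW.
  have := geo (2 * N%:Z); have := geo (- (2 * N%:Z)); have := geo 0.
  by under [X in _ -> X <= _ -> _]eq_bigr do rewrite opprK; rewrite /u /v /w; lra.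
Qed.

(** * Integrals over segments *)

Section segment_integral.
Context {R : realType}.
Implicit Types f : R -> R.

Lemma continuous_integrable_segment f (u v : R) : continuous f ->
  mu.-integrable `[u, v] (EFin \o f).
Proof.
move=> cf; apply: continuous_compact_integrable; first exact: segment_compact.
exact: continuous_subspaceT.
Qed.

Lemma Rintegral_cst_segment (u v r : R) : u <= v ->
  \int[mu]_(x in `[u, v]) r = r * (v - u).
Proof.
rewrite le_eqVlt => /predU1P[->|uv].
  by rewrite set_itv1 Rintegral_set1 subrr mulr0.
by rewrite Rintegral_cst//= lebesgue_measure_itv/= lte_fin uv.
Qed.

Lemma continuous_sum (I : Type) (s : seq I) (F : I -> R -> R) :
  (forall i, continuous (F i)) -> continuous (fun x => \sum_(i <- s) F i x).
Proof. by move=> cF; apply: continuous_big => // -[x y]; exact: add_continuous. Qed.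

Lemma Rintegral_segment_sum (I : Type) (s : seq I) (F : I -> R -> R) (u v : R) :
  (forall i, continuous (F i)) ->
  \int[mu]_(x in `[u, v]) (\sum_(i <- s) F i x)
    = \sum_(i <- s) \int[mu]_(x in `[u, v]) F i x.
Proof.
move=> cF; elim: s => [|i s IH].
  by rewrite big_nil; under eq_Rintegral do rewrite big_nil; rewrite Rintegral_cst// mul0r.
rewrite big_cons -IH -RintegralD//.
- by under eq_Rintegral do rewrite big_cons.
- exact: continuous_integrable_segment.
- by apply: continuous_integrable_segment; exact: continuous_sum.
Qed.

Lemma Rintegral_FTC2 f (F : R -> R) (u v : R) : u <= v ->
  continuous f -> (forall x : R, is_derive x 1 F (f x)) ->
  \int[mu]_(x in `[u, v]) f x = F v - F u.
Proof.
rewrite le_eqVlt => /predU1P[->|uv] cf dF.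
  by rewrite set_itv1 Rintegral_set1 subrr.
have cF : continuous F.
  by move=> x; apply/differentiable_continuous/derivable1_diffP/ex_derive.
rewrite /Rintegral (@continuous_FTC2 _ f F)//.
- exact: continuous_subspaceT.
- split; first by move=> x _; apply: ex_derive.
  + exact/cvg_at_right_filter/cF.
  + exact/cvg_at_left_filter/cF.
- by move=> x _; rewrite derive1E; have [_ ->] := dF x.
Qed.

Lemma Rintegral_segment_shift f (c e : R) : 0 <= e -> continuous f ->
  \int[mu]_(x in `[c - e, c + e]) f x = \int[mu]_(x in `[- e, e]) f (x + c).
Proof.
move=> e0 cf.
have dF x : is_derive x (1 : R) (fun y : R => y + c) 1.
  have := is_deriveD (is_derive_id x (1 : R)) (is_derive_cst c x (1 : R)).
  by rewrite addr0.
have F'E : derive1 (fun y : R => y + c) = cst 1.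
  by apply/funext => x; rewrite derive1E; have [_ ->] := dF x.
have cF : continuous (fun y : R => y + c).
  by move=> x; apply/differentiable_continuous/derivable1_diffP/ex_derive.
have ee : - e <= e by lra.
rewrite [c - e]addrC [c + e]addrC /Rintegral.
rewrite (@integration_by_substitution_increasing _ (fun y => y + c) f (- e) e)//.
- by rewrite F'E; congr fine; apply: eq_integral => x _ /=; rewrite /= mulr1.
- by move=> x y _ _ xy; rewrite ltrD2r.
- by rewrite F'E => x _; exact: cst_continuous.
- by rewrite F'E; exact: is_cvg_cst.
- by rewrite F'E; exact: is_cvg_cst.
- split; first by move=> x _; apply: ex_derive.
  + exact/cvg_at_right_filter/cF.
  + exact/cvg_at_left_filter/cF.
- exact: continuous_subspaceT.
Qed.

End segment_integral.

(** * Fourier series and Bessel's inequality *)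

Lemma sin_pi_int (R : realType) (k : int) : sin (pi * k%:~R : R) = 0.
Proof.
suff H n : sin (pi * n%:R : R) = 0.
  have [|/ltW k0] := leP 0 k.
    by case: k => // n _; rewrite -pmulrn H.
  have [n ->] : exists n, k = - n%:Z by exists (absz k); lia.
  by rewrite mulrNz mulrN sinN -pmulrn H oppr0.
elim: n => [|n IH]; first by rewrite mulr0 sin0.
by rewrite -addn1 natrD mulrDr mulr1 sinDpi IH oppr0.
Qed.

Lemma continuous_cos_line (R : realType) (v : R) : continuous (fun x : R => cos (v * x)).
Proof.
move=> x; apply: continuous_comp; last exact: continuous_cos.
exact: mulrl_continuous.
Qed.

Lemma continuous_sin_line (R : realType) (v : R) : continuous (fun x : R => sin (v * x)).
Proof.
move=> x; apply: continuous_comp; last exact: continuous_sin.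
exact: mulrl_continuous.
Qed.

Section fourier.
Variables (R : realType) (a b : R).
Hypotheses (a0 : 0 < a) (ab : a * b = 1 / 2).
Implicit Types n : int.

Let w n : R := 2 * pi * (b * n%:~R).

(** Here [a * b = 1 / 2] makes the frequencies [b * n] the harmonics of a period of length
    [2 * a]. *)
Let wa n : w n * a = pi * n%:~R.
Proof.
have -> : w n * a = 2 * (a * b) * (pi * n%:~R) by rewrite /w; ring.
by rewrite ab; field.
Qed.

Let is_derive_line (v x : R) : is_derive x (1 : R) (fun y : R => v * y) v.
Proof.
have := is_deriveZ v (is_derive_id x (1 : R)).
by rewrite /GRing.scale/= mulr1.
Qed.

Lemma Rintegral_cos_period n :
  \int[mu]_(x in `[- a, a]) cos (w n * x) = if n == 0 then 2 * a else 0.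
Proof.
have aa : - a <= a by move: a0; lra.
case: eqP => [->|/eqP n0].
  have w0 : w 0 = 0 by rewrite /w !mulr0.
  under eq_Rintegral do rewrite w0 mul0r cos0.
  by rewrite Rintegral_cst_segment// opprK mul1r mulr2n mulrDl mul1r.
have wn0 : w n != 0.
  apply/eqP => w0; have /eqP := wa n; rewrite w0 mul0r eq_sym mulf_eq0 intr_eq0.
  by rewrite (negbTE n0) (gt_eqF (pi_gt0 R)).
have dF (x : R) :
    is_derive x 1 (fun y : R => (w n)^-1 * sin (w n * y)) (cos (w n * x)).
  have := is_deriveZ (w n)^-1
    (is_derive1_comp (is_derive_sin (w n * x)) (is_derive_line (w n) x)).
  by rewrite /GRing.scale/= mulrC mulfK.
rewrite (Rintegral_FTC2 aa (@continuous_cos_line _ _) dF).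
by rewrite mulrN sinN wa sin_pi_int oppr0 mulr0 subrr.
Qed.

Lemma Rintegral_sin_period n : \int[mu]_(x in `[- a, a]) sin (w n * x) = 0.
Proof.
have aa : - a <= a by move: a0; lra.
case: (eqVneq n 0) => [->|n0].
  have w0 : w 0 = 0 by rewrite /w !mulr0.
  under eq_Rintegral do rewrite w0 mul0r sin0.
  by rewrite Rintegral_cst// mul0r.
have wn0 : w n != 0.
  apply/eqP => w0; have /eqP := wa n; rewrite w0 mul0r eq_sym mulf_eq0 intr_eq0.
  by rewrite (negbTE n0) (gt_eqF (pi_gt0 R)).
have dF (x : R) :
    is_derive x 1 (fun y : R => - (w n)^-1 * cos (w n * y)) (sin (w n * x)).
  have := is_deriveZ (- (w n)^-1)
    (is_derive1_comp (is_derive_cos (w n * x)) (is_derive_line (w n) x)).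
  by rewrite /GRing.scale/= mulNr mulNr mulrN opprK mulrC mulfK.
rewrite (Rintegral_FTC2 aa (@continuous_sin_line _ _) dF).
by rewrite mulrN cosN subrr.
Qed.

End fourier.

Lemma le_Rintegral_segment (R : realType) (f : R -> R) (u v u' v' : R) :
  continuous f -> (forall x, 0 <= f x) -> u' <= u -> v <= v' ->
  \int[mu]_(x in `[u, v]) f x <= \int[mu]_(x in `[u', v']) f x.
Proof.
move=> cf f0 uu vv; rewrite /Rintegral fine_le//.
- exact/integrable_fin_num/continuous_integrable_segment.
- exact/integrable_fin_num/continuous_integrable_segment.
apply: ge0_subset_integral => //=.
- exact: (measurable_int _ (continuous_integrable_segment _ _ cf)).
- by move=> x _; rewrite lee_fin f0.
- move=> x /=; rewrite !in_itv/= => /andP[ux xv].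
  by rewrite (le_trans uu ux) (le_trans xv vv).
Qed.

Section bessel.
Variables (R : realType) (a b e B : R) (G : R -> R) (s : seq int).
Hypotheses (a0 : 0 < a) (ab : a * b = 1 / 2) (e0 : 0 <= e) (ea : e <= a).
Hypotheses (cG : continuous G) (GB : forall x, `|x| <= e -> `|G x| <= B).
Hypothesis us : uniq s.

Let w (n : int) : R := 2 * pi * (b * n%:~R).
Let C n := \int[mu]_(x in `[- e, e]) (G x * cos (w n * x)).
Let S n := \int[mu]_(x in `[- e, e]) (G x * sin (w n * x)).
Let Q := \sum_(n <- s) (C n ^+ 2 + S n ^+ 2).
(** [T + i U] is the sum over [s] of [(C n - i S n) exp (i (w n) x)]: up to the factor [2 * a], a
    partial Fourier sum on [[-a, a]] of [G] cut off to [[-e, e]]. *)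
Let T x := \sum_(n <- s) (C n * cos (w n * x) + S n * sin (w n * x)).
Let U x := \sum_(n <- s) (C n * sin (w n * x) - S n * cos (w n * x)).

Let cont_mul (f g : R -> R) : continuous f -> continuous g ->
  continuous (fun x => f x * g x).
Proof. by move=> cf cg x; apply: cvgM; [exact: cf|exact: cg]. Qed.

Let cont_add (f g : R -> R) : continuous f -> continuous g ->
  continuous (fun x => f x + g x).
Proof. by move=> cf cg x; apply: cvgD; [exact: cf|exact: cg]. Qed.

Let cont_cmul (c : R) (f : R -> R) : continuous f -> continuous (fun x => c * f x).
Proof. by move=> cf x; apply: cvgM; [exact: cvg_cst|exact: cf]. Qed.

Let cc n := @continuous_cos_line R (w n).
Let cs n := @continuous_sin_line R (w n).

Let RintD (f g : R -> R) (u v : R) : continuous f -> continuous g ->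
  \int[mu]_(x in `[u, v]) (f x + g x) =
  \int[mu]_(x in `[u, v]) f x + \int[mu]_(x in `[u, v]) g x.
Proof. by move=> cf cg; rewrite RintegralD//; exact: continuous_integrable_segment. Qed.

Let RintZ (c : R) (f : R -> R) (u v : R) : continuous f ->
  \int[mu]_(x in `[u, v]) (c * f x) = c * \int[mu]_(x in `[u, v]) f x.
Proof. by move=> cf; rewrite RintegralZl//; exact: continuous_integrable_segment. Qed.

Let int_GT : \int[mu]_(x in `[- e, e]) (G x * T x) = Q.
Proof.
transitivity (\int[mu]_(x in `[- e, e]) (\sum_(n <- s)
    (C n * (G x * cos (w n * x)) + S n * (G x * sin (w n * x))))).
  apply: eq_Rintegral => x _; rewrite mulr_sumr; apply: eq_bigr => n _; ring.
have c1 n : continuous (fun x => C n * (G x * cos (w n * x))).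
  by apply/cont_cmul/cont_mul => //; exact: cc.
have c2 n : continuous (fun x => S n * (G x * sin (w n * x))).
  by apply/cont_cmul/cont_mul => //; exact: cs.
rewrite Rintegral_segment_sum; last by move=> n; exact: cont_add.
apply: eq_bigr => n _; rewrite RintD// !RintZ ?expr2//.
- by apply: cont_mul => //; exact: cs.
- by apply: cont_mul => //; exact: cc.
Qed.

(* [T + i U] is a trigonometric polynomial, so its squared modulus only
   involves cosines and sines of the differences of frequencies. *)
Let TU x : T x ^+ 2 + U x ^+ 2 = \sum_(n <- s) \sum_(m <- s)
  ((C n * C m + S n * S m) * cos (w (n - m) * x)
   + (S n * C m - C n * S m) * sin (w (n - m) * x)).
Proof.
rewrite !expr2 /T /U !big_distrlr/= -big_split/=; apply: eq_bigr => n _.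
rewrite -big_split/=; apply: eq_bigr => m _.
have -> : w (n - m) * x = w n * x - w m * x by rewrite /w mulrzBr; ring.
by rewrite cosB sinB; ring.
Qed.

Let cTU : continuous (fun x => T x ^+ 2 + U x ^+ 2).
Proof.
have cT : continuous T.
  by apply: continuous_sum => n; apply: cont_add; apply: cont_cmul; [exact: cc|exact: cs].
have cU : continuous U.
  apply: continuous_sum => n; apply: cont_add; first by apply: cont_cmul; exact: cs.
  by move=> x; apply: cvgN; apply: cont_cmul; exact: cc.
by apply: cont_add; apply: cont_mul.
Qed.

(** Orthogonality over a full period: the sines integrate to 0 and the cosines survive only for
    [n = m], which is met once per [n] because [s] is duplicate-free. *)
Let int_TU : \int[mu]_(x in `[- a, a]) (T x ^+ 2 + U x ^+ 2) = 2 * a * Q.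
Proof.
under eq_Rintegral do rewrite TU.
have c1 n m : continuous (fun x => (C n * C m + S n * S m) * cos (w (n - m) * x)).
  exact/cont_cmul/cc.
have c2 n m : continuous (fun x => (S n * C m - C n * S m) * sin (w (n - m) * x)).
  exact/cont_cmul/cs.
rewrite Rintegral_segment_sum; last first.
  by move=> n; apply: continuous_sum => m; exact: cont_add.
rewrite /Q mulr_sumr; apply: eq_big_seq => n ns.
rewrite Rintegral_segment_sum; last by move=> m; exact: cont_add.
have E m : \int[mu]_(x in `[- a, a]) ((C n * C m + S n * S m) * cos (w (n - m) * x)
   + (S n * C m - C n * S m) * sin (w (n - m) * x)) =
   (C n * C m + S n * S m) * (if n == m then 2 * a else 0).
  rewrite RintD// !RintZ; [|exact: cs|exact: cc].
  by rewrite Rintegral_cos_period// Rintegral_sin_period// mulr0 addr0 subr_eq0.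
under eq_bigr do rewrite E.
rewrite (bigD1_seq n)//= eqxx big1 ?addr0; first by ring.
by move=> m mn; rewrite eq_sym (negbTE mn) mulr0.
Qed.

(** Integrate [4 a G T <= 4 a^2 B^2 + T^2 + U^2] over [[-e, e]]. The left side gives [4 a Q];
    including [U] lets the last two terms, enlarged to [[-a, a]], be evaluated by orthogonality as
    [2 a Q], which is then absorbed. *)
Lemma bessel_segment : Q <= 4 * a * e * B ^+ 2.
Proof.
have cT : continuous T.
  by apply: continuous_sum => n; apply: cont_add; apply: cont_cmul; [exact: cc|exact: cs].
have ee : - e <= e by move: e0; lra.
have H1 : \int[mu]_(x in `[- e, e]) (4 * a * (G x * T x)) <=
    \int[mu]_(x in `[- e, e]) (4 * a ^+ 2 * B ^+ 2 + (T x ^+ 2 + U x ^+ 2)).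
  apply: le_Rintegral => //.
  - by apply/continuous_integrable_segment/cont_cmul/cont_mul.
  - apply/continuous_integrable_segment/cont_add => //; exact: cst_continuous.
  - move=> x; rewrite /= in_itv/= -ler_norml => xe.
    have GB2 : G x ^+ 2 <= B ^+ 2.
      by rewrite -real_normK ?num_real// ler_pXn2r ?nnegrE ?(le_trans _ (GB xe)) ?GB.
    (* [0 <= (2 a G - T)^2], and [T^2 <= T^2 + U^2] *)
    have := sqr_ge0 (2 * a * G x - T x); have := sqr_ge0 (U x).
    have := ler_wpM2l (sqr_ge0 (2 * a)) GB2.
    by lra.
have H2 : \int[mu]_(x in `[- e, e]) (T x ^+ 2 + U x ^+ 2) <= 2 * a * Q.
  rewrite -int_TU; apply: le_Rintegral_segment => //.
  - by move=> x; rewrite addr_ge0 ?sqr_ge0.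
  - by rewrite lerN2.
move: H1; rewrite RintZ; last exact: cont_mul.
rewrite RintD//; last exact: cst_continuous.
rewrite Rintegral_cst_segment// int_GT => H1.
have {H1 H2} : 2 * a * Q <= 2 * a * (4 * a * e * B ^+ 2) by lra.
by rewrite ler_pM2l// mulr_gt0.
Qed.

End bessel.

(** * The test functions *)

Lemma esum_int_le (R : realType) (F : int -> R) (C : R) :
  (forall s : seq int, uniq s -> \sum_(n <- s) F n <= C) ->
  (\esum_(n in [set: int]) (F n)%:E <= C%:E)%E.
Proof.
move=> FC; apply: ge_ereal_sup => _ [X [finX _] <-].
by rewrite fsbig_finite//= sumEFin lee_fin; exact/FC/finmap.fset_uniq.
Qed.

Lemma esum_rect_lattice_le (R : realType) (a b C : R) (F : R * R -> R)
    (D : int -> R) :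
  0 < a -> 0 < b -> (forall z, 0 <= F z) ->
  (forall (m : int) (s : seq int), uniq s ->
     \sum_(n <- s) F (a * m%:~R, b * n%:~R) <= D m) ->
  (forall s : seq int, uniq s -> \sum_(m <- s) D m <= C) ->
  (\esum_(z in rect_lattice a b) (F z)%:E <= C%:E)%E.
Proof.
move=> a0 b0 F0 FD DC.
pose g (p : int * int) : R * R := (a * p.1%:~R, b * p.2%:~R).
have -> : rect_lattice a b = g @` ([set: int] `*`` fun=> [set: int]).
  apply/seteqP; split => [[x y] [/= [m _ <-] [n _ <-]]|_ [[m n] _ <-]]/=.
    by exists (m, n).
  by split; [exists m|exists n].
rewrite esum_image; last first.
  move=> [m n] [m' n'] _ _ [] /= /(mulfI (lt0r_neq0 a0))/intr_inj mm.
  by move=> /(mulfI (lt0r_neq0 b0))/intr_inj nn; rewrite mm nn.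
rewrite -(@esum_esum _ _ _ setT (fun=> setT) (fun m n => (F (g (m, n)))%:E))//; last first.
  by move=> *; rewrite lee_fin.
apply: le_trans (esum_int_le DC).
by apply: le_esum => m _; apply: esum_int_le => s us; exact: FD.
Qed.

Lemma cosD_2pi_int (R : realType) (x : R) (k : int) :
  cos (x + 2 * pi * k%:~R) = cos x.
Proof.
have s0 := sin_pi_int R k; have c1 := cos2Dsin2 (pi * k%:~R : R).
have -> : 2 * pi * k%:~R = (pi * k%:~R) *+ 2 :> R by rewrite mulr2n; ring.
rewrite cosD cos_mulr2n sin_mulr2n s0 mulr0 mul0rn mulr0 subr0.
by move: c1; rewrite s0 expr0n addr0 => ->; rewrite mulr2n addrK mulr1.
Qed.

Lemma sinD_2pi_int (R : realType) (x : R) (k : int) :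
  sin (x + 2 * pi * k%:~R) = sin x.
Proof. by rewrite -!cosBpihalf addrAC cosD_2pi_int. Qed.

Section comb.
Variables (R : realType) (a e : R) (N : nat).
Hypotheses (e0 : 0 < e).

Let c (j : nat) : R := a * (2 * j%:Z - 2 * N%:Z)%:~R.
Let I (j : nat) : set R := `[c j - e, c j + e].

(* Nothing forces the intervals to be disjoint: [comb] takes natural values, so
   [comb <= comb ^+ 2] suffices to bound its norm from below. *)
Definition comb (t : R) : R := \sum_(0 <= j < (2 * N).+1) \1_(I j) t.

Lemma combE t : exists k : nat, comb t = k%:R /\ (k <= (2 * N).+1)%N.
Proof.
exists (\sum_(0 <= j < (2 * N).+1) (t \in I j))%N; split.
  by rewrite /comb natr_sum; apply: eq_bigr => j _; rewrite indicE.
rewrite -[leqRHS]muln1 -[X in (_ <= X * _)%N]subn0 -sum_nat_const_nat.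
by apply: leq_sum => j _; exact: leq_b1.
Qed.

Lemma measurable_comb : measurable_fun [set: R] comb.
Proof.
apply: measurable_sum => j; apply: measurable_indic; exact: measurable_itv.
Qed.

Let combM (K : R -> R) t :
  comb t * K t = \sum_(0 <= j < (2 * N).+1) (K \_ (I j)) t.
Proof.
rewrite /comb mulr_suml; apply: eq_bigr => j _.
by rewrite patch_indic /= mulrC.
Qed.

Let integrable_piece (K : R -> R) j : continuous K ->
  mu.-integrable [set: R] (EFin \o (K \_ (I j))).
Proof.
move=> cK; rewrite -restrict_EFin.
have mI : measurable (I j : set (measurableTypeR R)) by exact: measurable_itv.
exact: (integrable_mkcond _ mI).1 (continuous_integrable_segment _ _ cK).
Qed.

Lemma integrable_comb (K : R -> R) : continuous K ->
  mu.-integrable [set: R] (EFin \o (fun t => comb t * K t)).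
Proof.
move=> cK; rewrite (_ : _ \o _ =
    (fun t => \sum_(0 <= j < (2 * N).+1) ((K \_ (I j)) t)%:E)%E); last first.
  by apply/funext => t; rewrite sumEFin /= combM.
by apply: integrable_sum => // j _; exact: integrable_piece.
Qed.

Lemma Rintegral_comb (K : R -> R) : continuous K ->
  \int[mu]_t (comb t * K t) =
  \sum_(0 <= j < (2 * N).+1) \int[mu]_(x in `[- e, e]) K (x + c j).
Proof.
move=> cK; rewrite /Rintegral.
under eq_integral do rewrite combM -sumEFin.
rewrite integral_sum//; last by move=> j; exact: integrable_piece.
rewrite -EFin_sum_fine; last first.
  by move=> j _; exact/integrable_fin_num/integrable_piece.
apply: eq_bigr => j _.
have := Rintegral_segment_shift (c j) (ltW e0) cK.
by rewrite Rintegral_mkcond.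
Qed.

(** The left inequality bounds the norm of [comb] from below, the right one shows that it is
    finite. *)
Let comb_sqr t : comb t <= comb t ^+ 2 <= (2 * N).+1%:R * comb t.
Proof.
have [k [-> kN]] := combE t.
rewrite expr2 -!natrM !ler_nat leq_mul2r kN orbT andbT.
by case: k {kN} => // k; rewrite leq_pmulr.
Qed.

Lemma Rintegral_comb1 : \int[mu]_t comb t = (2 * N).+1%:R * (2 * e).
Proof.
have := @Rintegral_comb (cst 1) (@cst_continuous _ _ _).
under eq_Rintegral do rewrite /= mulr1.
have ee : - e <= e by move: e0; lra.
move=> ->; under eq_bigr do rewrite (Rintegral_cst_segment 1 ee).
by rewrite sumr_const_nat subn0 -[LHS]mulr_natl; congr (_ * _); lra.
Qed.

Lemma L2norm_comb_sqr :
  (((2 * N).+1%:R * (2 * e))%:E <= L2norm (fun t => (comb t)%:C) ^+ 2 < +oo)%E.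
Proof.
have mc := measurable_comb.
have ic : mu.-integrable [set: R] (EFin \o comb).
  have := @integrable_comb (cst 1) (@cst_continuous _ _ _).
  by congr (mu.-integrable _ _); apply/funext => t /=; rewrite mulr1.
have mc2 : measurable_fun [set: R] (fun t => (comb t ^+ 2)%:E).
  by apply/measurable_EFinP; exact: measurable_funX.
have -> : (L2norm (fun t => (comb t)%:C) ^+ 2 = \int[mu]_t (comb t ^+ 2)%:E)%E.
  rewrite /L2norm.
  have -> : (Lnorm mu 2%:E (fun t => (normc (comb t)%:C)%:E) ^+ 2 =
     Lnorm mu 2%:E (fun t => (normc (comb t)%:C)%:E) `^ 2)%E.
    have := Lnorm_ge0 mu 2%:E (fun t => (normc (comb t)%:C)%:E).
    case: (Lnorm _ _ _) => [r|_|]//; last by rewrite poweRyr.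
    by rewrite lee_fin => r0; rewrite poweR_EFin -[2 in RHS]/(2%:R) powR_mulrn// EFin_expe.
  rewrite poweR_Lnorm//; apply: eq_integral => t _.
  rewrite /= expr0n addr0 sqrtr_sqr normr_id -[2 in LHS]/(2%:R).
  by rewrite powR_mulrn// real_normK// num_real.
apply/andP; split.
  rewrite -Rintegral_comb1 /Rintegral fineK; last exact: integrable_fin_num.
  apply: ge0_le_integral => //.
  - move=> t _; rewrite lee_fin; have [k [-> _]] := combE t; exact: ler0n.
  - exact/measurable_EFinP.
  - by move=> t _; rewrite lee_fin; case/andP: (comb_sqr t).
apply: (@le_lt_trans _ _ (\int[mu]_t ((2 * N).+1%:R * comb t)%:E)%E).
  apply: ge0_le_integral => //.
  - by move=> t _; rewrite lee_fin sqr_ge0.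
  - by apply/measurable_EFinP; exact: measurable_funM.
  - by move=> t _; rewrite lee_fin; case/andP: (comb_sqr t).
have ic2 : mu.-integrable [set: R] (EFin \o (fun t => (2 * N).+1%:R * comb t)).
  by under [_ \o _]eq_fun do rewrite EFinM; exact: integrableZl.
by rewrite ltey_eq; apply/orP; left; exact: integrable_fin_num.
Qed.

End comb.

(** * Frame coefficients of the test functions *)

Section comb_coefficients.
Variables (R : realType) (a b e : R) (N : nat) (H : R -> R).
Hypotheses (ab : a * b = 1 / 2) (e0 : 0 < e) (cH : continuous H).

Lemma continuous_lattice_sum (m : int) : continuous (lattice_sum H a N m).
Proof.
apply: continuous_sum => j x; apply: continuous_comp; last exact: cH.
by apply: cvgD; [exact: cvg_id|exact: cvg_cst].
Qed.

Section trig.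
Variables (tau : R -> R) (m n : int).
Hypotheses (ctau : continuous tau)
  (tau_per : forall x (k : int), tau (x + 2 * pi * k%:~R) = tau x).

Let K (t : R) := H (t - a * m%:~R) * tau (2 * pi * (b * n%:~R) * t).

Let cK : continuous K.
Proof.
move=> x; apply: cvgM.
  apply: (continuous_comp (f := fun t => t - a * m%:~R)); last exact: cH.
  by apply: cvgD; [exact: cvg_id|exact: cvg_cst].
apply: (continuous_comp (f := fun t => 2 * pi * (b * n%:~R) * t)); last exact: ctau.
exact: mulrl_continuous.
Qed.

Lemma integrable_comb_trig :
  mu.-integrable [set: R] (EFin \o (fun t => comb a e N t * K t)).
Proof. exact: integrable_comb. Qed.

(** [tau] stands for cosine or sine. Translating by [2 a k] moves its phase by [2 pi n k], as
    [2 a b = 1]; so [tau] factors out and the translates of [H] add up to [lattice_sum]. *)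
Lemma Rintegral_comb_trig : \int[mu]_t (comb a e N t * K t) =
  \int[mu]_(x in `[- e, e]) (lattice_sum H a N m x * tau (2 * pi * (b * n%:~R) * x)).
Proof.
rewrite Rintegral_comb//.
rewrite -Rintegral_segment_sum; last first.
  move=> j x; apply: (continuous_comp (f := fun t => t + a * (2 * j%:Z - 2 * N%:Z)%:~R)).
    by apply: cvgD; [exact: cvg_id|exact: cvg_cst].
  exact: cK.
apply: eq_Rintegral => x _; rewrite /lattice_sum mulr_suml.
apply: eq_bigr => j _; rewrite /K -addrA -mulrBr -intrB; congr (_ * _).
rewrite mulrDr.
have -> : 2 * pi * (b * n%:~R) * (a * (2 * j%:Z - 2 * N%:Z)%:~R) =
    2 * pi * (n * (j%:Z - N%:Z))%:~R.
  have -> : 2 * j%:Z - 2 * N%:Z = 2 * (j%:Z - N%:Z) by ring.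
  rewrite !intrM.
  have -> : 2 * pi * (b * n%:~R) * (a * (2%:~R * (j%:Z - N%:Z)%:~R)) =
    (a * b) * 2 * (2 * pi * (n%:~R * (j%:Z - N%:Z)%:~R)) :> R by ring.
  by rewrite ab; field.
exact: tau_per.
Qed.

End trig.

Lemma normc_L2inner_comb (c : R[i]) (h : R -> R[i]) (m n : int) :
  (forall t, h t = c * (H t)%:C) ->
  normc (L2inner (fun t => (comb a e N t)%:C)
           (tfshift (a * m%:~R, b * n%:~R) h)) ^+ 2 =
  normc c ^+ 2 *
    ((\int[mu]_(x in `[- e, e])
        (lattice_sum H a N m x * cos (2 * pi * (b * n%:~R) * x))) ^+ 2
     + (\int[mu]_(x in `[- e, e])
        (lattice_sum H a N m x * sin (2 * pi * (b * n%:~R) * x))) ^+ 2).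
Proof.
move=> hE; case: c hE => c1 c2 hE.
set P := \int[mu]_(x in _) (_ * cos _); set Q := \int[mu]_(x in _) (_ * sin _).
have iP := integrable_comb_trig m n (@continuous_cos R).
have iQ := integrable_comb_trig m n (@continuous_sin R).
have EP : _ = P := Rintegral_comb_trig m n (@continuous_cos R) (@cosD_2pi_int R).
have EQ : _ = Q := Rintegral_comb_trig m n (@continuous_sin R) (@sinD_2pi_int R).
have intZ (r : R) (f : R -> R) : mu.-integrable [set: R] (EFin \o f) ->
    mu.-integrable [set: R] (EFin \o (fun t => r * f t)).
  by move=> fi; under [_ \o _]eq_fun do rewrite EFinM; exact: integrableZl.
(* As [comb] and [H] are real, the coefficient is the product of the conjugates of [c1 + i c2] and
   [P + i Q]. *)
have -> : L2inner (fun t => (comb a e N t)%:C) (tfshift (a * m%:~R, b * n%:~R) h)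
    = (c1 * P - c2 * Q) +i* - (c2 * P + c1 * Q).
  rewrite /L2inner /tfshift /expi; congr (_ +i* _).
    rewrite -EP -EQ -!RintegralZl//; rewrite -RintegralB//; [|exact: intZ|exact: intZ].
    apply: eq_Rintegral => t _; rewrite hE /=.
    ring.
  have -> : - (c2 * P + c1 * Q) = - c2 * P + - c1 * Q by ring.
  rewrite -EP -EQ -!RintegralZl// -RintegralD//; [|exact: intZ|exact: intZ].
  apply: eq_Rintegral => t _; rewrite hE /=.
  ring.
rewrite /normc !sqr_sqrtr ?addr_ge0 ?sqr_ge0//; ring.
Qed.

End comb_coefficients.

(** * Failure of the lower frame bound *)

Lemma L2_comb (R : realType) (a e : R) (N : nat) :
  0 < e -> L2 (fun t => (comb a e N t)%:C).
Proof.
move=> e0; split => /=; [exact: measurable_comb|exact: measurable_cst|].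
have /andP[_] := L2norm_comb_sqr a N e0.
have := Lnorm_ge0 (@lebesgue_measure R) 2%:E (fun t => (normc (comb a e N t)%:C)%:E).
rewrite -/(L2norm _); case: (L2norm _) => [r _ _||]; [exact: ltry| |by []].
by rewrite expe2 mulyy.
Qed.

(** The factor [expR (pi * t ^+ 2)] turns the differentiated Gaussian into [expR (- pi * t ^+ 2)],
    and an odd number of derivatives leaves an odd polynomial. *)
Lemma hermite_odd (R : realType) (n : nat) (h : R -> R[i]) :
  is_hermite (2 * n + 1) h -> exists (c : R[i]) (p : {poly R}),
    p \Po - 'X = - p /\ forall t, h t = c * (p.[t] * expR (- pi * t ^+ 2))%:C.
Proof.
move=> [c [hE _]].
have [p [pN pE]] := derive1n_gauss (- 2 * pi : R) (2 * n + 1).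
exists c, p; split.
  by rewrite pN addn1 exprS exprM sqrrN expr1n expr1n mulr1 scaleN1r.
move=> t; rewrite hE pE; congr (_ * _%:C).
by rewrite mulrCA -expRD; congr (_ * expR _); ring.
Qed.

Theorem proposition4p3 (R : realType) (a b : R) (ha : 0 < a) (hb : 0 < b)
  (hab : a * b = 1 / 2) (n : nat) (h : R -> complex R)
  (hh : is_hermite (2 * n + 1)%N h) :
  ~ gabor_frame h (rect_lattice a b).
Proof.
move=> [A [A' [A0 _ hA]]].
have [c [p [pN hE]]] := hermite_odd hh.
pose H (t : R) := p.[t] * expR (- pi * t ^+ 2).
have Hodd t : H (- t) = - H t.
  have := congr1 (horner^~ t) pN; rewrite horner_comp !hornerE => pt.
  by rewrite /H pt sqrrN mulNr.
have cH : continuous H.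
  move=> t; have dH := is_derive_poly_gauss p (- pi) t.
  by apply/differentiable_continuous/derivable1_diffP/ex_derive.
have [K1 [K10 HK1]] := poly_gauss_decay p.
have [K2 [K20 HK2]] := poly_gauss_lipschitz p.
pose K := K1 + K2.
have [] := @lattice_sum_bound R a K H ha _ Hodd.
- by rewrite addr_ge0.
- move=> t; rewrite (le_trans (HK1 t))// ler_wpM2r ?expR_ge0//.
  by rewrite lerDl.
- move=> t x x1; rewrite (le_trans (HK2 t x x1))// !ler_wpM2r ?expR_ge0//.
  by rewrite lerDr.
move=> C bound; pose M : R := normc c ^+ 2 * (4 * a * C).
(* Both sides of the lower frame inequality carry the factor [e], which depends on [N]; after its
   cancellation the right side [M] is independent of [N]. *)
suff frameN N : A * ((2 * N).+1%:R * 2) <= M.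
  (* For this [N], [M / A < N + 1 <= (2 N + 1) * 2], a contradiction. *)
  have := frameN (Num.truncn (M / A)).
  rewrite -ler_pdivlMl// [A^-1 * M]mulrC leNgt => /negP; apply.
  have : M / A < (Num.truncn (M / A)).+1%:R by exact: truncnS_gt.
  move=> /lt_le_trans; apply; rewrite -natrM ler_nat; lia.
have [e [B [e0 ea hB sB]]] := bound N.
have /andP[Nle _] := L2norm_comb_sqr a N e0.
have /andP[+ _] := hA _ (L2_comb a N e0).
move=> /(le_trans (lee_wpmul2l _ Nle)); rewrite lee_fin => /(_ (ltW A0)).
(* [D m] is the Bessel bound for the coefficients at all [(a m, b n)] with [m] fixed, [B m] being
   the supremum bound for the lattice sum. *)
move=> /le_trans/(_ (esum_rect_lattice_le (C := M * e)
   (D := fun m => normc c ^+ 2 * (4 * a * e * B m ^+ 2)) ha hb _ _ _)).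
rewrite -EFinM lee_fin => /(_ (fun=> sqr_ge0 _)) H0.
rewrite -(ler_pM2r e0).
have -> : A * ((2 * N).+1%:R * 2) * e = A * ((2 * N).+1%:R * (2 * e)) by ring.
apply: H0.
- move=> m s us; under eq_bigr do rewrite (normc_L2inner_comb N hab e0 cH _ _ hE)//.
  rewrite -mulr_sumr ler_wpM2l ?sqr_ge0//.
  apply: bessel_segment => //; first exact: ltW.
  + exact: continuous_lattice_sum.
  + exact: hB.
- move=> s us; rewrite -!mulr_sumr.
  have -> : M * e = normc c ^+ 2 * (4 * a * e * C) by rewrite /M; ring.
  apply: ler_wpM2l; first exact: sqr_ge0.
  by apply: ler_wpM2l; [rewrite !mulr_ge0// ltW|exact: sB].
Qed.
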